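(* Let $(a_{n,m})_{n,m\in\mathbb N_0}$ be a sequence of $N\times N$ quaternionic matrices such that $a_{n,m}=a_{m,n}^*$, and assume that the power series $$K(p,q)=\sum_{n,m=0}^\infty p^na_{n,m}\overline q^{\,m}$$ converges (for $p,q$) in a neighborhood $V$ of the origin of $\mathbb H$. Let $\kappa\in\mathbb N_0$. Then the following are equivalent: (1) The function $K(p,q)$ has $\kappa$ negative squares in $V$. (2) All the finite matrices $A_\mu=(a_{n,m})_{n,m=0,\ldots,\mu}$ have at most $\kappa$ strictly negative eigenvalues, and exactly $\kappa$ strictly negative eigenvalues for at least one $\mu\in\mathbb N_0$.
   Context: $\mathbb H$ denotes the quaternions, $\mathbb N_0=\{0,1,2,\dots\}$. A Hermitian $\mathbb H^{N\times N}$-valued kernel $K$ on $V$ has $\kappa$ negative squares in $V$ if for every $M\in\mathbb N$, all $p_1,\dots,p_M\in V$ and all $c_1,\dots,c_M\in\mathbb H^N$, the Hermitian matrix with $(\ell,j)$ entry $c_\ell^*K(p_\ell,p_j)c_j$ has at most $\kappa$ strictly negative eigenvalues (counted with multiplicity), and exactly $\kappa$ for some choice of $M$, points and vectors. Eigenvalues of a quaternionic Hermitian matrix are its (real) right eigenvalues. $A_\mu$ is regarded as a Hermitian matrix in $\mathbb H^{(\mu+1)N\times(\mu+1)N}$. *)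

(* Defs.v *)
From HB Require Import structures.
From mathcomp Require Import all_boot all_order all_algebra.
From mathcomp Require Import ring lra.
From mathcomp Require Import all_classical all_reals all_analysis.

Set Implicit Arguments.
Unset Strict Implicit.
Unset Printing Implicit Defensive.

Import Order.TTheory GRing.Theory Num.Theory.
Import numFieldNormedType.Exports.

Local Open Scope classical_set_scope.
Local Open Scope ring_scope.

(* [Quat a b c d] is the quaternion a + b i + c j + d k. *)
Record quat (R : realType) := Quat { qre : R; qi : R; qj : R; qk : R }.

Section QuaternionRing.
Context {R : realType}.
Implicit Types x y z : quat R.

Definition quat_tuple x := (qre x, qi x, qj x, qk x).
Definition tuple_quat (t : R * R * R * R) :=
  let: (a, b, c, d) := t in Quat a b c d.

Lemma quat_tupleK : cancel quat_tuple tuple_quat.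
Proof. by case. Qed.

HB.instance Definition _ := Choice.copy (quat R) (can_type quat_tupleK).

Lemma eq_quat x y :
  qre x = qre y -> qi x = qi y -> qj x = qj y -> qk x = qk y -> x = y.
Proof. by case: x y => a b c d [a' b' c' d'] /= -> -> -> ->. Qed.

Definition quat_add x y :=
  Quat (qre x + qre y) (qi x + qi y) (qj x + qj y) (qk x + qk y).
Definition quat_opp x := Quat (- qre x) (- qi x) (- qj x) (- qk x).
Definition quat_mul x y :=
  Quat (qre x * qre y - qi x * qi y - qj x * qj y - qk x * qk y)
       (qre x * qi y + qi x * qre y + qj x * qk y - qk x * qj y)
       (qre x * qj y - qi x * qk y + qj x * qre y + qk x * qi y)
       (qre x * qk y + qi x * qj y - qj x * qi y + qk x * qre y).
Definition quat_scale (l : R) x :=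
  Quat (l * qre x) (l * qi x) (l * qj x) (l * qk x).

Fact quat_addA : associative quat_add.
Proof. by move=> x y z; apply: eq_quat => /=; ring. Qed.
Fact quat_addC : commutative quat_add.
Proof. by move=> x y; apply: eq_quat => /=; ring. Qed.
Fact quat_add0 : left_id (Quat 0 0 0 0) quat_add.
Proof. by move=> x; apply: eq_quat => /=; ring. Qed.
Fact quat_addN : left_inverse (Quat 0 0 0 0) quat_opp quat_add.
Proof. by move=> x; apply: eq_quat => /=; ring. Qed.

HB.instance Definition _ :=
  GRing.isZmodule.Build (quat R) quat_addA quat_addC quat_add0 quat_addN.

Fact quat_mulA : associative quat_mul.
Proof. by move=> x y z; apply: eq_quat => /=; ring. Qed.
Fact quat_mul1l : left_id (Quat 1 0 0 0) quat_mul.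
Proof. by move=> x; apply: eq_quat => /=; ring. Qed.
Fact quat_mul1r : right_id (Quat 1 0 0 0) quat_mul.
Proof. by move=> x; apply: eq_quat => /=; ring. Qed.
Fact quat_mulDl : left_distributive quat_mul +%R.
Proof. by move=> x y z; apply: eq_quat => /=; ring. Qed.
Fact quat_mulDr : right_distributive quat_mul +%R.
Proof. by move=> x y z; apply: eq_quat => /=; ring. Qed.
Fact quat_one_neq0 : Quat 1 0 0 0 != 0 :> quat R.
Proof. by apply/eqP => -[/eqP]; rewrite oner_eq0. Qed.

HB.instance Definition _ := GRing.Zmodule_isNzRing.Build (quat R)
  quat_mulA quat_mul1l quat_mul1r quat_mulDl quat_mulDr quat_one_neq0.

Fact quat_scaleA (a b : R) x :
  quat_scale a (quat_scale b x) = quat_scale (a * b) x.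
Proof. by apply: eq_quat => /=; ring. Qed.
Fact quat_scale1 : left_id 1 quat_scale.
Proof. by move=> x; apply: eq_quat => /=; ring. Qed.
Fact quat_scaleDr : right_distributive quat_scale +%R.
Proof. by move=> a x y; apply: eq_quat => /=; ring. Qed.
Fact quat_scaleDl x : {morph quat_scale^~ x : a b / a + b}.
Proof. by move=> a b; apply: eq_quat => /=; ring. Qed.

HB.instance Definition _ := GRing.Zmodule_isLmodule.Build R (quat R)
  quat_scaleA quat_scale1 quat_scaleDr quat_scaleDl.

Definition quat_conj x : quat R := Quat (qre x) (- qi x) (- qj x) (- qk x).

Definition quat_real (r : R) : quat R := Quat r 0 0 0.

Definition quat_norm x : R :=
  Num.sqrt (qre x ^+ 2 + qi x ^+ 2 + qj x ^+ 2 + qk x ^+ 2).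

Fact quat_normD x y : quat_norm (x + y) <= quat_norm x + quat_norm y.
Proof.
have ge0 z : 0 <= qre z ^+ 2 + qi z ^+ 2 + qj z ^+ 2 + qk z ^+ 2.
  by rewrite !addr_ge0 ?sqr_ge0.
rewrite -ler_sqr ?nnegrE ?addr_ge0 ?sqrtr_ge0// sqrrD.
rewrite !sqr_sqrtr ?ge0//.
have -> : quat_norm x * quat_norm y = Num.sqrt
    ((qre x ^+ 2 + qi x ^+ 2 + qj x ^+ 2 + qk x ^+ 2) *
     (qre y ^+ 2 + qi y ^+ 2 + qj y ^+ 2 + qk y ^+ 2)) by rewrite sqrtrM ?ge0.
set s := Num.sqrt _.
suff : qre x * qre y + qi x * qi y + qj x * qj y + qk x * qk y <= s.
  by move=> le_s /=; rewrite mulr2n; lra.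
apply: le_trans (ler_norm _) _; rewrite -sqrtr_sqr ler_wsqrtr//.
case: x y {s} => a b c d [a' b' c' d'] /=.
have : 0 <= (a * b' - b * a') ^+ 2 + (a * c' - c * a') ^+ 2
    + (a * d' - d * a') ^+ 2 + (b * c' - c * b') ^+ 2
    + (b * d' - d * b') ^+ 2 + (c * d' - d * c') ^+ 2.
  by rewrite !addr_ge0 ?sqr_ge0.
by lra.
Qed.

Fact quat_normZ (l : R) x : quat_norm (l *: x) = `|l| * quat_norm x.
Proof.
rewrite -sqrtr_sqr -sqrtrM ?sqr_ge0//; congr Num.sqrt => /=.
by ring.
Qed.

Fact quat_norm0_eq0 x : quat_norm x = 0 -> x = 0.
Proof.
move/eqP; rewrite sqrtr_eq0 => le0.
have := (sqr_ge0 (qre x), sqr_ge0 (qi x), sqr_ge0 (qj x), sqr_ge0 (qk x)).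
move=> [[[a0 b0] c0] d0].
by apply: eq_quat; apply/eqP; rewrite -sqrf_eq0 eq_le /=; apply/andP; split;
  lra.
Qed.

HB.instance Definition _ :=
  Lmodule_isNormed.Build R (quat R) quat_normD quat_normZ quat_norm0_eq0.

End QuaternionRing.

Section QuaternionicMatrices.
Context {R : realType}.

Definition adjmx m n (A : 'M[quat R]_(m, n)) : 'M[quat R]_(n, m) :=
  map_mx quat_conj A^T.

(* Linear independence over the quaternions acting on the right. *)
Definition right_free n k (B : 'M[quat R]_(n, k)) : Prop :=
  forall c : 'cV[quat R]_k, B *m c = 0 -> c = 0.

(* Dimension of a right linear subspace E of H^n: the maximal number of right
   linearly independent vectors of E, which is at most n. *)
Definition right_dim n (E : set 'cV[quat R]_n) : nat :=
  \max_(k < n.+1 | `[< exists2 B : 'M[quat R]_(n, k),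
                         (forall j, E (col j B)) & right_free B >]) k.

Definition right_eigenvalue n (A : 'M[quat R]_n) (l : quat R) : Prop :=
  exists2 v : 'cV[quat R]_n, v != 0 & A *m v = v *m l%:M.

(* For a real l this is a right linear subspace, since l is central. *)
Definition right_eigenspace n (A : 'M[quat R]_n) (l : quat R)
    : set 'cV[quat R]_n :=
  [set v | A *m v = v *m l%:M].

(* The sum has finite support, as eigenvectors for distinct real eigenvalues
   are right linearly independent; for a Hermitian matrix all right eigenvalues
   are real and the matrix is diagonalizable, so the multiplicity of an
   eigenvalue is the dimension of its eigenspace. *)
Definition num_neg_eigenvalues n (A : 'M[quat R]_n) : nat :=
  \big[addn/0%N]_(l \in [set l : R | l < 0 /\ right_eigenvalue A (quat_real l)])
     right_dim (right_eigenspace A (quat_real l)).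

End QuaternionicMatrices.

Section Kernels.
Context {R : realType} {N : nat}.
Implicit Types (V : set (quat R)) (K : quat R -> quat R -> 'M[quat R]_N).

Definition hermitian_kernel V K : Prop :=
  forall p q, V p -> V q -> K p q = adjmx (K q p).

Definition gram_mx K M (p : 'I_M -> quat R) (c : 'I_M -> 'cV[quat R]_N)
    : 'M[quat R]_M :=
  \matrix_(l, j) (adjmx (c l) *m K (p l) (p j) *m c j) 0 0.

Definition has_negative_squares V K (kappa : nat) : Prop :=
  [/\ hermitian_kernel V K,
      forall (M : nat) (p : 'I_M -> quat R) (c : 'I_M -> 'cV[quat R]_N),
        (0 < M)%N -> (forall i, V (p i)) ->
        (num_neg_eigenvalues (gram_mx K p c) <= kappa)%N &
      exists (M : nat) (p : 'I_M -> quat R) (c : 'I_M -> 'cV[quat R]_N),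
        [/\ (0 < M)%N, forall i, V (p i) &
            num_neg_eigenvalues (gram_mx K p c) = kappa]].

Definition kernel_psum (a : nat -> nat -> 'M[quat R]_N) (p q : quat R)
    (nm : nat * nat) : 'M[quat R]_N :=
  \sum_(n < nm.1) \sum_(m < nm.2)
    (p ^+ n)%:M *m a n m *m (quat_conj q ^+ m)%:M.

(* Convergence of the double series in the sense of Pringsheim: the rectangular
   partial sums converge as both bounds tend to infinity independently.  It is
   implied by unconditional (equivalently, absolute) convergence. *)
Definition kernel_series_cvg (a : nat -> nat -> 'M[quat R]_N) (p q : quat R)
    (S : 'M[quat R]_N) : Prop :=
  kernel_psum a p q @ filter_prod \oo \oo --> S.

Definition coef_block (a : nat -> nat -> 'M[quat R]_N) (mu : nat)
    : 'M[quat R]_(\sum_(n < mu.+1) N) :=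
  \mxblock_(n < mu.+1, m < mu.+1) a n m.

End Kernels.

(* Main.v *)
(* Write nu(A) for the number of negative eigenvalues of a Hermitian matrix A.
   By the spectral theorem over the quaternions (obtained from the complex one),
   nu(A) is the largest dimension on which the form c^* A c is negative definite;
   hence nu(X^* A X) <= nu(A), and nu is lower semicontinuous.

   A Gram matrix of K is the limit of the Gram matrices of the square partial
   sums, and the mu-th of these is X^* A_mu X, so nu of the Gram matrix is at most
   nu(A_mu) for mu large.

   Conversely, take the points eps * l (l <= mu) on the real axis and the standard
   basis vectors, and combine the Gram matrix with the dual Vandermonde weights
   scaled by eps ^- r: the result is A_mu + O(eps), so nu(A_mu) is at most nu of
   the Gram matrix.  The estimate needs geometric growth of the coefficients.
   Rectangular convergence at one point does not bound the terms a_{n,m} with n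
   small, so the growth is extracted from convergence at uncountably many points. *)
From HB Require Import structures.
From mathcomp Require Import all_boot all_order all_algebra.
From mathcomp Require Import ring lra zify.
From mathcomp Require Import complex.
From mathcomp Require Import all_classical all_reals all_analysis.
Require Import Defs.

Set Implicit Arguments.
Unset Strict Implicit.
Unset Printing Implicit Defensive.

Import Order.TTheory GRing.Theory Num.Theory.
Import numFieldNormedType.Exports.

Local Open Scope classical_set_scope.
Local Open Scope ring_scope.

(** * Quaternion conjugation, real scalars and the multiplicative norm *)

Section QuaternionTheory.
Context {R : realType}.
Implicit Types (x y : quat R) (r s : R).

Fact quat_conj_zmod_morphism : zmod_morphism (@quat_conj R).
Proof. by move=> x y; apply: eq_quat => //=; rewrite opprD. Qed.

HB.instance Definition _ :=
  GRing.isZmodMorphism.Build (quat R) (quat R) quat_conj quat_conj_zmod_morphism.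

Fact qre_zmod_morphism : zmod_morphism (@qre R).
Proof. by []. Qed.

HB.instance Definition _ :=
  GRing.isZmodMorphism.Build (quat R) R (@qre R) qre_zmod_morphism.

Fact quat_real_zmod_morphism : zmod_morphism (@quat_real R).
Proof. by move=> r s; apply: eq_quat => //=; rewrite subrr. Qed.

Fact quat_real_monoid_morphism : monoid_morphism (@quat_real R).
Proof. by split=> // r s; apply: eq_quat => /=; ring. Qed.

HB.instance Definition _ := GRing.isZmodMorphism.Build R (quat R) (@quat_real R)
  quat_real_zmod_morphism.
HB.instance Definition _ := GRing.isMonoidMorphism.Build R (quat R)
  (@quat_real R) quat_real_monoid_morphism.

Lemma quat_conjK : involutive (@quat_conj R).
Proof. by move=> x; apply: eq_quat => //=; rewrite opprK. Qed.

Lemma quat_conjM x y : quat_conj (x * y) = quat_conj y * quat_conj x.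
Proof. by apply: eq_quat => /=; ring. Qed.

Lemma quat_conj_real r : quat_conj (quat_real r) = quat_real r.
Proof. by apply: eq_quat => //=; rewrite oppr0. Qed.

Lemma quat_conjX x n : quat_conj (x ^+ n) = quat_conj x ^+ n.
Proof.
elim: n => [|n IHn]; first exact: (quat_conj_real 1).
by rewrite exprS quat_conjM IHn -exprSr.
Qed.

Lemma quat_realM r x : quat_real r * x = r *: x.
Proof. by apply: eq_quat => /=; ring. Qed.

Lemma quat_mul_real x r : x * quat_real r = r *: x.
Proof. by apply: eq_quat => /=; ring. Qed.

Lemma quat_scalerAr r x y : r *: (x * y) = x * (r *: y).
Proof. by rewrite -!quat_mul_real mulrA. Qed.

Lemma quat_normE x :
  `|x| = Num.sqrt (qre x ^+ 2 + qi x ^+ 2 + qj x ^+ 2 + qk x ^+ 2).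
Proof. by []. Qed.

Lemma sqr_quat_norm x :
  `|x| ^+ 2 = qre x ^+ 2 + qi x ^+ 2 + qj x ^+ 2 + qk x ^+ 2.
Proof. by rewrite quat_normE sqr_sqrtr// !addr_ge0 ?sqr_ge0. Qed.

Lemma quat_normM x y : `|x * y| = `|x| * `|y|.
Proof.
rewrite !quat_normE -sqrtrM ?addr_ge0 ?sqr_ge0//; congr Num.sqrt => /=; ring.
Qed.

Lemma quat_norm_conj x : `|quat_conj x| = `|x|.
Proof. by rewrite !quat_normE /=; congr Num.sqrt; ring. Qed.

Lemma quat_norm_real r : `|quat_real r| = `|r|.
Proof. by rewrite quat_normE /= !expr0n /= !addr0 sqrtr_sqr. Qed.

Lemma quat_conj_mul x : quat_conj x * x = quat_real (`|x| ^+ 2).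
Proof. by rewrite sqr_quat_norm; apply: eq_quat => /=; ring. Qed.

Lemma qre_le_norm x : `|qre x| <= `|x|.
Proof.
rewrite -ler_sqr ?nnegrE// sqr_quat_norm real_normK ?num_real//.
by rewrite -!addrA lerDl !addr_ge0 ?sqr_ge0.
Qed.

End QuaternionTheory.

(** * Adjoints, Hermitian forms and entrywise bounds on them *)

Section Adjoint.
Context {R : realType}.

Lemma adjmxE m n (A : 'M[quat R]_(m, n)) i j : adjmx A i j = quat_conj (A j i).
Proof. by rewrite !mxE. Qed.

Lemma adjmxK m n (A : 'M[quat R]_(m, n)) : adjmx (adjmx A) = A.
Proof. by apply/matrixP => i j; rewrite !adjmxE quat_conjK. Qed.

Lemma adjmxM m n p (A : 'M[quat R]_(m, n)) (B : 'M[quat R]_(n, p)) :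
  adjmx (A *m B) = adjmx B *m adjmx A.
Proof.
apply/matrixP => i j; rewrite !mxE raddf_sum.
by apply: eq_bigr => k _; rewrite !mxE /= quat_conjM.
Qed.

Lemma adjmxB m n (A B : 'M[quat R]_(m, n)) : adjmx (A - B) = adjmx A - adjmx B.
Proof. by apply/matrixP => i j; rewrite !mxE raddfB. Qed.

Lemma adjmx_scalar n (x : quat R) :
  adjmx (x%:M : 'M[quat R]_n) = (quat_conj x)%:M.
Proof.
apply/matrixP => i j; rewrite !mxE eq_sym; case: eqP => _ //.
exact: (quat_conj_real 0).
Qed.

Lemma real_scalar_mxC m n r (A : 'M[quat R]_(m, n)) :
  A *m (quat_real r)%:M = (quat_real r)%:M *m A.
Proof.
apply/matrixP => i j; rewrite mul_scalar_mx !mxE (bigD1 j)//= big1 ?addr0.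
  by rewrite mxE eqxx mulr1n quat_mul_real -quat_realM.
by move=> k /negPf kj; rewrite !mxE kj mulr0n mulr0.
Qed.

(* Taking the real part loses nothing: c^* A c is real for Hermitian A. *)
Definition qform n (A : 'M[quat R]_n) (c : 'cV[quat R]_n) : R :=
  qre ((adjmx c *m A *m c) 0 0).

Lemma qformM n k (A : 'M[quat R]_n) (B : 'M[quat R]_(n, k)) c :
  qform A (B *m c) = qform (adjmx B *m A *m B) c.
Proof. by rewrite /qform adjmxM !mulmxA. Qed.

Lemma qformB n (A B : 'M[quat R]_n) c : qform (A - B) c = qform A c - qform B c.
Proof. by rewrite /qform mulmxBr mulmxBl !mxE raddfB. Qed.

Lemma qformN n (A : 'M[quat R]_n) c : qform (- A) c = - qform A c.
Proof. by rewrite /qform mulmxN mulNmx !mxE raddfN. Qed.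

Lemma qform1 n (c : 'cV[quat R]_n) : qform 1%:M c = \sum_i (`|c i 0| ^+ 2).
Proof.
rewrite /qform mulmx1 mxE raddf_sum; apply: eq_bigr => i _.
by rewrite adjmxE quat_conj_mul.
Qed.

Lemma qform1_gt0 n (c : 'cV[quat R]_n) : c != 0 -> 0 < qform 1%:M c.
Proof.
move=> c0; rewrite lt_def qform1 sumr_ge0 ?andbT => [|i _]; last exact: sqr_ge0.
apply: contra c0; rewrite psumr_eq0 => [|i _]; last exact: sqr_ge0.
move=> /allP c0; apply/eqP/colP => i; rewrite mxE; apply/eqP.
by rewrite -normr_eq0 -sqrf_eq0; apply: c0; rewrite mem_index_enum.
Qed.

Definition real_diag n (d : 'rV[R]_n) : 'M[quat R]_n :=
  diag_mx (map_mx quat_real d).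

Lemma adjmx_real_diag n (d : 'rV[R]_n) : adjmx (real_diag d) = real_diag d.
Proof.
apply/matrixP => i j; rewrite !mxE eq_sym.
by case: eqP => [->|_]; [apply: quat_conj_real | apply: (quat_conj_real 0)].
Qed.

Lemma qform_diag n (d : 'rV[R]_n) c :
  qform (real_diag d) c = \sum_i d 0 i * `|c i 0| ^+ 2.
Proof.
rewrite /qform mxE raddf_sum; apply: eq_bigr => i _.
rewrite mul_mx_diag !mxE -mulrA quat_realM -quat_scalerAr quat_conj_mul.
by rewrite /=.
Qed.

Lemma norm_sesquilinear_le m n (u : 'cV[quat R]_m) (v : 'cV[quat R]_n)
    (E : 'M[quat R]_(m, n)) (e : R) : (forall i j, `|E i j| <= e) ->
  `|(adjmx u *m E *m v) 0 0| <= e * ((\sum_i (`|u i 0|)) * \sum_i (`|v i 0|)).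
Proof.
move=> Ee; rewrite mxE big_distrr/= mulr_sumr.
apply: le_trans (ler_norm_sum _ _ _) (ler_sum _ _) => j _.
rewrite quat_normM mulrA ler_wpM2r// mxE mulr_sumr.
apply: le_trans (ler_norm_sum _ _ _) (ler_sum _ _) => i _.
by rewrite quat_normM adjmxE quat_norm_conj mulrC ler_wpM2r.
Qed.

Lemma norm_qform_le n (A : 'M[quat R]_n) c e : (forall i j, `|A i j| <= e) ->
  `|qform A c| <= e * (\sum_i (`|c i 0|)) ^+ 2.
Proof.
by move=> /norm_sesquilinear_le Ae; rewrite (le_trans (qre_le_norm _)) ?expr2.
Qed.

End Adjoint.

(** * Kernels and eigenvectors by transfer to complex matrices *)

Section Complexification.
Context {R : realType}.
Local Notation C := (R[i]%C).

(* A quaternion is x + y j with x, y complex; the two parts are x and the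
   conjugate of y.  In these coordinates left multiplication by a quaternionic
   matrix and right multiplication by a complex scalar are both complex linear. *)
Definition cpart1 (x : quat R) : C := Complex (qre x) (qi x).
Definition cpart2 (x : quat R) : C := Complex (qj x) (- qk x).

Definition quat_of_cparts (z w : C) : quat R :=
  Quat (complex.Re z) (complex.Im z) (complex.Re w) (- complex.Im w).

Lemma cpart1K z w : cpart1 (quat_of_cparts z w) = z.
Proof. by case: z. Qed.

Lemma cpart2K z w : cpart2 (quat_of_cparts z w) = w.
Proof. by case: w => a b; rewrite /cpart2 /= opprK. Qed.

Lemma quat_of_cpartsK x : quat_of_cparts (cpart1 x) (cpart2 x) = x.
Proof. by apply: eq_quat => //=; rewrite opprK. Qed.

Fact cpart1_zmod_morphism : zmod_morphism cpart1.
Proof. by []. Qed.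
Fact cpart2_zmod_morphism : zmod_morphism cpart2.
Proof. by move=> x y; rewrite /cpart2 /= opprD. Qed.
HB.instance Definition _ :=
  GRing.isZmodMorphism.Build (quat R) C cpart1 cpart1_zmod_morphism.
HB.instance Definition _ :=
  GRing.isZmodMorphism.Build (quat R) C cpart2 cpart2_zmod_morphism.

Lemma conjCE (z : C) : Num.conj z = conjc z.
Proof. by []. Qed.

Lemma cpart1M x y :
  cpart1 (x * y) = cpart1 x * cpart1 y - conjc (cpart2 x) * cpart2 y.
Proof. by apply/eqP; rewrite eq_complex /=; apply/andP; split; apply/eqP; ring. Qed.

Lemma cpart2M x y :
  cpart2 (x * y) = cpart2 x * cpart1 y + conjc (cpart1 x) * cpart2 y.
Proof. by apply/eqP; rewrite eq_complex /=; apply/andP; split; apply/eqP; ring. Qed.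

Definition ccol m n (B : 'M[quat R]_(m, n)) : 'M[C]_(m + m, n) :=
  col_mx (map_mx cpart1 B) (map_mx cpart2 B).

(** Left multiplication by [A] in the coordinates of [ccol]: the usual embedding of quaternionic
    matrices into complex matrices of twice the size. *)
Definition cmat m n (A : 'M[quat R]_(m, n)) : 'M[C]_(m + m, n + n) :=
  block_mx (map_mx cpart1 A) (- map_mx (conjc \o cpart2) A)
           (map_mx cpart2 A) (map_mx (conjc \o cpart1) A).

Lemma ccolM m n p (A : 'M[quat R]_(m, n)) (B : 'M[quat R]_(n, p)) :
  ccol (A *m B) = cmat A *m ccol B.
Proof.
rewrite /ccol /cmat mul_block_col; congr col_mx; apply/matrixP => i j.
  rewrite !mxE raddf_sum /= -big_split /=; apply: eq_bigr => k _.
  by rewrite !mxE cpart1M mulNr.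
rewrite !mxE raddf_sum /= -big_split /=; apply: eq_bigr => k _.
by rewrite !mxE cpart2M.
Qed.

Definition uncol m n (w : 'M[C]_(m + m, n)) : 'M[quat R]_(m, n) :=
  \matrix_(i, j) quat_of_cparts (usubmx w i j) (dsubmx w i j).

Lemma uncolK m n (w : 'M[C]_(m + m, n)) : ccol (uncol w) = w.
Proof.
rewrite -[RHS]vsubmxK; congr col_mx; apply/matrixP => i j.
  by rewrite !mxE cpart1K.
by rewrite !mxE cpart2K.
Qed.

Lemma ccol_inj m n : injective (@ccol m n).
Proof.
move=> A B /eq_col_mx [/matrixP eq1 /matrixP eq2]; apply/matrixP => i j.
have := eq1 i j; have := eq2 i j; rewrite !mxE => e2 e1.
by rewrite -[LHS]quat_of_cpartsK e1 e2 quat_of_cpartsK.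
Qed.

Lemma ccol0 m n : ccol (0 : 'M[quat R]_(m, n)) = 0.
Proof. by rewrite /ccol !raddf0 col_mx0. Qed.

Lemma cmat_eq0 m n (A : 'M[quat R]_(m, n)) : cmat A = 0 -> A = 0.
Proof.
move=> A0; apply: ccol_inj; rewrite ccol0 -[RHS]col_mx0.
have /eq_block_mx[e1 _ e2 _] : cmat A = block_mx 0 0 0 0 by rewrite block_mx0.
by rewrite /ccol e1 e2.
Qed.

Lemma ccolZ m n (l : R) (B : 'M[quat R]_(m, n)) :
  ccol (B *m (quat_real l)%:M) = (real_complex R l) *: ccol B.
Proof.
rewrite real_scalar_mxC mul_scalar_mx /ccol scale_col_mx.
by congr col_mx; apply/matrixP => i j; rewrite !mxE ?cpart1M ?cpart2M;
  apply/eqP; rewrite eq_complex /=; apply/andP; split; apply/eqP; ring.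
Qed.

Lemma cmat_herm n (A : 'M[quat R]_n) :
  A = adjmx A -> (cmat A)^T = map_mx Num.conj (cmat A).
Proof.
move=> Ah; rewrite /cmat tr_block_mx map_block_mx.
have Aij i j : A i j = quat_conj (A j i) by rewrite {1}Ah adjmxE.
congr block_mx; apply/matrixP => i j; rewrite !mxE conjCE [A j i]Aij;
  by apply/eqP; rewrite eq_complex /= ?opprK ?oppr0 ?eqxx.
Qed.

(** The complex matrix [cmat B] has more columns than rows, so it kills a nonzero complex column,
    which [uncol] turns into a quaternionic one. The transposes are there because [kermx] is a left
    kernel. *)
Lemma wide_ker n k (B : 'M[quat R]_(n, k)) : (n < k)%N ->
  exists2 c : 'cV[quat R]_k, c != 0 & B *m c = 0.
Proof.
move=> nk; have : kermx (cmat B)^T != 0.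
  rewrite -mxrank_eq0 mxrank_ker subn_eq0 -ltnNge.
  by apply: leq_ltn_trans (rank_leq_col _) _; rewrite !addnn ltn_double.
move=> /rowV0Pn [v /sub_kermxP vB v0].
exists (uncol v^T).
  apply: contra v0 => /eqP v0; rewrite -[v]trmxK -[v^T]uncolK v0 ccol0.
  by rewrite trmx0.
by apply: ccol_inj; rewrite ccolM uncolK ccol0 -[cmat B]trmxK -trmx_mul vB trmx0.
Qed.

(** By the complex spectral theorem for [cmat A], the columns of [invmx P] form a basis of
    eigenvectors with real eigenvalues, and each is [ccol] of a quaternionic eigenvector. Testing
    against [M] expresses spanning without choosing a basis. *)
Lemma hermitian_eigenvectors_span n (A M : 'M[quat R]_n) :
  A = adjmx A ->
  (forall (v : 'cV[quat R]_n) l, A *m v = v *m (quat_real l)%:M -> M *m v = 0) ->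
  M = 0.
Proof.
move=> Ah Mv; apply: cmat_eq0.
have cAh : cmat A \is hermitianmx (n + n) false Num.conj.
  by apply/is_hermitianmxP; rewrite expr0 scale1r -map_trmx -cmat_herm// trmxK.
have /orthomx_spectralP := hermitian_normalmx cAh.
have := hermitian_spectral_diag_real cAh; have := spectral_unit (cmat A).
move: (spectralmx _) (spectral_diag _) => P d Punit dreal cAE.
suff MP : cmat M *m invmx P = 0.
  by rewrite -[cmat M](mulmxKV Punit) MP mul0mx.
have cAP : cmat A *m invmx P = invmx P *m diag_mx d by rewrite cAE mulmxK.
apply/matrixP => i j; rewrite [RHS]mxE.
suff /colP/(_ i) : col j (cmat M *m invmx P) = 0 by rewrite !mxE.
have [l dj] : exists l, d 0 j = real_complex R l.
  exact/complex_realP/(mxOverP dreal).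
rewrite colE -mulmxA -colE -[col j _]uncolK -ccolM (Mv _ l) ?ccol0//.
apply: ccol_inj; rewrite ccolM ccolZ uncolK -dj colE mulmxA cAP.
by rewrite -!colE; apply/colP => k; rewrite mul_mx_diag !mxE mulrC.
Qed.

End Complexification.

(** * The quaternionic spectral theorem *)

Section Inertia.
Context {R : realType}.

Lemma isometry_leq n k (U : 'M[quat R]_(n, k)) :
  adjmx U *m U = 1%:M -> (k <= n)%N.
Proof.
move=> UU; rewrite leqNgt; apply/negP => /(wide_ker U)[c /eqP c0 Uc].
by apply: c0; rewrite -[c]mul1mx -UU -mulmxA Uc mulmx0.
Qed.

Lemma hermitian_eigenvector n (A P : 'M[quat R]_n) : A = adjmx A -> P != 0 ->
  exists v : 'cV[quat R]_n, exists2 l,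
    A *m v = v *m (quat_real l)%:M & P *m v != 0.
Proof.
move=> Ah /eqP P0; apply: contrapT => nv; apply: P0.
apply: (hermitian_eigenvectors_span Ah) => v l Av.
by apply: contrapT => Pv; apply: nv; exists v, l => //; apply/eqP.
Qed.

Lemma adj_mul_cV n (v : 'cV[quat R]_n) :
  adjmx v *m v = (quat_real (qform 1%:M v))%:M.
Proof.
apply/matrixP => i j; rewrite !ord1 mxE [RHS]mxE mulr1n qform1 raddf_sum.
by apply: eq_bigr => k _; rewrite adjmxE quat_conj_mul.
Qed.

Lemma unit_eigenvector n (A : 'M[quat R]_n) (v : 'cV[quat R]_n) l :
  A *m v = v *m (quat_real l)%:M -> v != 0 ->
  exists2 r : R, adjmx (v *m (quat_real r)%:M) *m (v *m (quat_real r)%:M) = 1%:M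
    & A *m (v *m (quat_real r)%:M) = v *m (quat_real r)%:M *m (quat_real l)%:M.
Proof.
move=> Av v0; have s_gt0 := qform1_gt0 v0; set s := qform _ _ in s_gt0.
exists (Num.sqrt s)^-1; last first.
  by rewrite mulmxA Av -!mulmxA; congr (_ *m _); apply: real_scalar_mxC.
rewrite adj_mul_cV; congr _%:M; rewrite -[RHS](rmorph1 (@quat_real R)).
congr quat_real; rewrite qform1.
under eq_bigr => i _.
  rewrite real_scalar_mxC mul_scalar_mx mxE quat_normM quat_norm_real exprMn.
  over.
rewrite -mulr_sumr -qform1 -/s real_normK ?num_real//.
by rewrite exprVn sqr_sqrtr ?ltW// mulVf ?gt_eqF.
Qed.

(** An orthonormal family of eigenvectors of maximal size is a full basis: the projection [P] onto
    its orthogonal complement commutes with [A], so a nonzero [P] would map some eigenvector to a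
    nonzero eigenvector orthogonal to the family. *)
Lemma hermitian_spectral n (A : 'M[quat R]_n) : A = adjmx A ->
  exists (U : 'M[quat R]_n) (d : 'rV[R]_n),
    [/\ adjmx U *m U = 1%:M, U *m adjmx U = 1%:M & A *m U = U *m real_diag d].
Proof.
move=> Ah.
pose eigenfamily k := `[< exists (U : 'M[quat R]_(n, k)) (d : 'rV[R]_k),
  adjmx U *m U = 1%:M /\ A *m U = U *m real_diag d >].
have ex0 : exists k, eigenfamily k.
  by exists 0%N; apply/asboolP; exists 0, 0; split; apply/matrixP => i [].
have le_n k : eigenfamily k -> (k <= n)%N.
  by move=> /asboolP[U [d [/isometry_leq]]].
case: (ex_maxnP ex0 le_n) => k /asboolP[U [d [UU AU]]] kmax.
pose P := 1%:M - U *m adjmx U.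
have UP : adjmx U *m P = 0 by rewrite mulmxBr mulmx1 mulmxA UU mul1mx subrr.
have AP : A *m P = P *m A.
  rewrite mulmxBr mulmxBl mulmx1 mul1mx mulmxA AU; congr (_ - _).
  have := congr1 (@adjmx _ _ _) AU; rewrite !adjmxM -Ah adjmx_real_diag.
  by rewrite -!mulmxA => ->.
have P0 : P = 0.
  apply/eqP/negPn/negP => /(hermitian_eigenvector Ah)[v [l Av Pv]].
  have APv : A *m (P *m v) = P *m v *m (quat_real l)%:M.
    by rewrite mulmxA AP -!mulmxA Av.
  have [r] := unit_eigenvector APv Pv; set w := _ *m (quat_real r)%:M => ww Aw.
  have Uw : adjmx U *m w = 0 by rewrite /w !mulmxA UP !mul0mx.
  have /kmax : eigenfamily (k + 1)%N; last by rewrite addn1 ltnn.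
  apply/asboolP; exists (row_mx U w), (row_mx d l%:M).
  have -> : adjmx (row_mx U w) = col_mx (adjmx U) (adjmx w).
    by rewrite /adjmx tr_row_mx map_col_mx.
  split.
    rewrite mul_col_row UU ww Uw -(adjmxK (adjmx w *m U)) adjmxM adjmxK Uw.
    have -> : adjmx 0 = 0 :> 'M[quat R]_(1, k).
      by rewrite -(subrr 0) adjmxB subrr.
    by rewrite -scalar_mx_block.
  rewrite mul_mx_row /real_diag map_row_mx diag_mx_row mul_row_block.
  rewrite !mulmx0 add0r addr0 -/(real_diag d) AU Aw; congr (row_mx _ (_ *m _)).
  by apply/matrixP => i j; rewrite !ord1 !mxE !mulr1n.
have UU' : U *m adjmx U = 1%:M by apply/esym/eqP; rewrite -subr_eq0 -/P P0.
(* Both [U] and its adjoint are isometries, which bounds [k] and [n] by each other. *)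
have kn : k = n.
  apply/eqP; rewrite eqn_leq (isometry_leq UU)/= (@isometry_leq _ _ (adjmx U))//.
  by rewrite adjmxK.
by move: U d UU UU' AU {P UP AP P0 kmax}; rewrite kn => U d; exists U, d.
Qed.

End Inertia.

(** * Counting negative eigenvalues in a diagonalizing basis *)

Section NegativeEigenvalues.
Context {R : realType}.

Section Diagonalized.
Context (n : nat) (A U : 'M[quat R]_n) (d : 'rV[R]_n).
Hypotheses (UU : adjmx U *m U = 1%:M) (UU' : U *m adjmx U = 1%:M)
  (AU : A *m U = U *m real_diag d).

Let UA : adjmx U *m A = real_diag d *m adjmx U.
Proof.
by rewrite -[A in LHS]mulmx1 -UU' (mulmxA A) AU !mulmxA UU mul1mx.
Qed.

Lemma unitary_diag_eigenvector k (B : 'M[quat R]_(n, k)) l i j :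
  A *m B = B *m (quat_real l)%:M -> d 0 i != l -> (adjmx U *m B) i j = 0.
Proof.
move=> AB dil; have := congr1 (mulmx (adjmx U)) AB.
rewrite !mulmxA UA -mulmxA real_scalar_mxC mul_scalar_mx.
move: (adjmx U *m B) => X /matrixP/(_ i j); rewrite mul_diag_mx !mxE => /eqP.
rewrite !quat_realM -subr_eq0 -scalerBl scaler_eq0 subr_eq0 (negPf dil) /=.
by move=> /eqP.
Qed.

(** An eigenvector for [l] has zero coordinates outside [S], so more than [#|S|] of them are
    dependent by [wide_ker]; conversely the columns of [U] indexed by [S] are eigenvectors, and they
    are free because they are orthonormal. *)
Lemma right_dim_eigenspace l :
  right_dim (right_eigenspace A (quat_real l)) = #|[pred i | d 0 i == l]|.
Proof.
set S := [pred i | _]; apply/eqP; rewrite eqn_leq; apply/andP; split.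
  apply/bigmax_leqP => k /asboolP[B EB Bfree]; rewrite leqNgt; apply/negP.
  have AB : A *m B = B *m (quat_real l)%:M.
    apply/matrixP => i j; have := EB j.
    rewrite /right_eigenspace /= real_scalar_mxC !colE !mulmxA -!colE.
    by rewrite -real_scalar_mxC => /colP/(_ i); rewrite mxE => ->; rewrite mxE.
  move=> /(wide_ker (rowsub (enum_val : 'I_#|S| -> 'I_n) (adjmx U *m B))).
  move=> [c /eqP c0 Bc]; apply/c0/Bfree.
  rewrite -[B *m c]mul1mx -UU' -mulmxA (_ : adjmx U *m (B *m c) = 0) ?mulmx0//.
  rewrite mulmxA; apply/colP => i; rewrite [RHS]mxE.
  have [iS|iNS] := boolP (i \in S).
    have /colP/(_ (enum_rank_in iS i)) := Bc.
    by rewrite mul_rowsub_mx mxE enum_rankK_in// => ->; rewrite mxE.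
  rewrite mxE big1// => j _; rewrite (@unitary_diag_eigenvector _ _ l) ?mul0r//.
have Sn : (#|S| < n.+1)%N by rewrite ltnS -[X in (_ <= X)%N]card_ord max_card.
apply: (leq_bigmax_cond (Ordinal Sn)).
pose f : 'I_#|S| -> 'I_n := enum_val.
apply/asboolP; exists (colsub f U) => [j|c Bc].
  have -> : col j (colsub f U) = col (f j) U by apply/colP => i; rewrite !mxE.
  rewrite /right_eigenspace /= !colE mulmxA AU -mulmxA -!mulmxA; congr (U *m _).
  apply/colP => i; rewrite real_scalar_mxC mul_scalar_mx mul_diag_mx !mxE.
  case: eqP => [->|]; last by rewrite !mulr0.
  by have := enum_valP j; rewrite inE => /eqP <-.
rewrite -[c]mul1mx.
have -> : 1%:M = adjmx (colsub f U) *m colsub f U.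
  have /matrixP UUE := UU; apply/matrixP => i j; have := UUE (f i) (f j).
  rewrite !mxE (inj_eq enum_val_inj) => <-.
  by apply: eq_bigr => k _; rewrite !mxE.
by rewrite -mulmxA Bc mulmx0.
Qed.

Lemma right_eigenvalue_diag l :
  right_eigenvalue A (quat_real l) <-> exists i, d 0 i = l.
Proof.
split=> [[v /eqP v0 Av]|[i <-]].
  apply: contrapT => nd; apply: v0; rewrite -[v]mul1mx -UU' -mulmxA.
  rewrite (_ : adjmx U *m v = 0) ?mulmx0//; apply/matrixP => i j.
  rewrite (unitary_diag_eigenvector _ Av) ?mxE//.
  by apply/eqP => dil; apply: nd; exists i.
exists (col i U).
  apply/eqP => Ui; have /matrixP/(_ i i) := UU.
  rewrite !mxE eqxx big1 => [/esym/eqP|k _]; first by rewrite oner_eq0.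
  by have /colP/(_ k) := Ui; rewrite !mxE => ->; rewrite mulr0.
rewrite !colE mulmxA AU -!mulmxA; congr (U *m _).
apply/colP => j; rewrite real_scalar_mxC mul_scalar_mx mul_diag_mx !mxE.
by case: eqP => [->|]; rewrite ?mulr0.
Qed.

Lemma num_neg_eigenvalues_diag :
  num_neg_eigenvalues A = #|[pred i | d 0 i < 0]|.
Proof.
rewrite /num_neg_eigenvalues.
pose s : seq R := undup [seq d 0 i | i <- enum [pred i | d 0 i < 0]].
have sP (l : R) : reflect (exists2 i, d 0 i < 0 & l = d 0 i) (l \in s).
  rewrite mem_undup.
  apply: (iffP (@seq.mapP _ _ _ _ _)) => -[i di0 ->]; exists i => //.
    by move: di0; rewrite mem_enum inE.
  by rewrite mem_enum inE.
have -> : [set l : R | l < 0 /\ right_eigenvalue A (quat_real l)]%classic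
    = [set` s]%classic.
  apply/seteqP; split=> l /=.
    by move=> [l0 /right_eigenvalue_diag[i dil]]; apply/sP; exists i; rewrite ?dil.
  move=> /sP[i di0 ->].
  by split=> //; apply/right_eigenvalue_diag; exists i.
rewrite -fsbig_seq ?undup_uniq//.
under eq_bigr => l _ do rewrite right_dim_eigenspace -sum1_card big_mkcond.
(* After the exchange the inner sum counts how often [d 0 i] occurs in the duplicate-free list [s]:
   once if it is negative, otherwise never. *)
rewrite exchange_big -sum1_card [RHS]big_mkcond; apply: eq_bigr => i _ /=.
rewrite -big_mkcond sum1_count (@eq_count _ _ (pred1 (d 0 i))) => [|l]; last first.
  by rewrite /= inE eq_sym.
rewrite count_uniq_mem ?undup_uniq// inE.
case: sP => [[j dj0 ->]|nd]; first by rewrite dj0.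
by case: ltP => // di0; case: nd; exists i.
Qed.

(** If [k] exceeded the number of negative [d 0 i], some nonzero [c] would make the coordinates of
    [B *m c] at those indices vanish, and the form would be nonnegative there. *)
Lemma leq_num_neg_eigenvalues_diag k (B : 'M[quat R]_(n, k)) :
  (forall c, c != 0 -> qform A (B *m c) < 0) ->
  (k <= num_neg_eigenvalues A)%N.
Proof.
move=> Aneg; rewrite num_neg_eigenvalues_diag leqNgt; apply/negP.
set S := [pred i | _].
move=> /(wide_ker (rowsub (enum_val : 'I_#|S| -> 'I_n) (adjmx U *m B))).
move=> [c /Aneg + Bc]; rewrite ltNge => /negP; apply.
have -> : A = adjmx (adjmx U) *m real_diag d *m adjmx U.
  by rewrite adjmxK -AU -mulmxA UU' mulmx1.
rewrite -qformM mulmxA qform_diag; apply: sumr_ge0 => i _.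
have [di0|di0] := leP 0 (d 0 i); first by rewrite mulr_ge0.
have iS : i \in S by rewrite inE.
have /colP/(_ (enum_rank_in iS i)) := Bc.
by rewrite mul_rowsub_mx mxE enum_rankK_in// => ->; rewrite mxE normr0 expr0n mulr0.
Qed.

Lemma neg_orthonormal_family_diag :
  exists B : 'M[quat R]_(n, num_neg_eigenvalues A),
    adjmx B *m A *m B = - 1%:M.
Proof.
rewrite num_neg_eigenvalues_diag; set S := [pred i | _].
pose f : 'I_#|S| -> 'I_n := enum_val.
have fneg j : d 0 (f j) < 0 by have := enum_valP j; rewrite inE.
(* Scaling by the inverse square root of [- d] normalizes the value of the form on each column to
   [-1]. *)
pose s : 'rV[R]_#|S| := \row_j (Num.sqrt (- d 0 (f j)))^-1.
exists (colsub f U *m real_diag s).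
rewrite adjmxM adjmx_real_diag.
have -> : adjmx (colsub f U) = rowsub f (adjmx U).
  by apply/matrixP => i j; rewrite !mxE.
rewrite -!mulmxA (mulmxA A) mulmx_colsub AU (mulmxA (rowsub f _)).
rewrite mulmx_colsub mul_rowsub_mx (mulmxA (adjmx U)) UU mul1mx.
apply/matrixP => i j.
rewrite mul_diag_mx mul_mx_diag !mxE (inj_eq enum_val_inj).
have [->|_] := eqVneq i j; last by rewrite !mulr0n mul0r mulr0 oppr0.
rewrite !mulr1n -!rmorphM /= -(rmorph1 (@quat_real R)) -rmorphN; congr quat_real.
rewrite mulrC -mulrA -invfM -expr2 sqr_sqrtr ?oppr_ge0 ?ltW//.
by rewrite invrN mulrN mulfV ?lt_eqF.
Qed.

End Diagonalized.

End NegativeEigenvalues.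

(** * Congruence and semicontinuity of the number of negative eigenvalues *)

Section Perturbation.
Context {R : realType}.

Lemma leq_num_neg_eigenvalues n k (A : 'M[quat R]_n) (B : 'M[quat R]_(n, k)) :
  A = adjmx A -> (forall c, c != 0 -> qform A (B *m c) < 0) ->
  (k <= num_neg_eigenvalues A)%N.
Proof.
by move=> /hermitian_spectral[U [d [UU UU' AU]]];
   apply: (leq_num_neg_eigenvalues_diag UU UU' AU).
Qed.

Lemma exists_neg_orthonormal_family n (A : 'M[quat R]_n) : A = adjmx A ->
  exists B : 'M[quat R]_(n, num_neg_eigenvalues A),
    forall c, qform A (B *m c) = - qform 1%:M c.
Proof.
move=> /hermitian_spectral[U [d [UU UU' AU]]].
have [B BAB] := neg_orthonormal_family_diag UU UU' AU.
by exists B => c; rewrite qformM BAB qformN.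
Qed.

(** A family [B] on which the form of the compressed matrix is minus the identity is carried by [X]
    to one on which the form of [A] is negative definite. *)
Lemma num_neg_eigenvalues_congruence n k (A : 'M[quat R]_n)
    (X : 'M[quat R]_(n, k)) : A = adjmx A ->
  (num_neg_eigenvalues (adjmx X *m A *m X) <= num_neg_eigenvalues A)%N.
Proof.
move=> Ah.
have Xh : adjmx X *m A *m X = adjmx (adjmx X *m A *m X).
  by rewrite !adjmxM adjmxK -Ah mulmxA.
have [B BE] := exists_neg_orthonormal_family Xh.
apply: (@leq_num_neg_eigenvalues _ _ _ (X *m B)) => // c c0.
by rewrite -mulmxA qformM BE oppr_lt0 qform1_gt0.
Qed.

Lemma sum_norm_mulmx_cV n k (B : 'M[quat R]_(n, k)) (c : 'cV[quat R]_k) :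
  (\sum_i (`|(B *m c) i 0|)) ^+ 2 <=
  (\sum_i \sum_j (`|B i j|)) ^+ 2 * qform 1%:M c.
Proof.
set s := qform _ _; have s0 : 0 <= s.
  by rewrite /s qform1 sumr_ge0// => i _; rewrite sqr_ge0.
have cs j : `|c j 0| <= Num.sqrt s.
  rewrite -ler_sqr ?nnegrE ?sqrtr_ge0// (sqr_sqrtr s0) /s qform1 (bigD1 j)//=.
  by rewrite lerDl sumr_ge0// => i _; rewrite sqr_ge0.
rewrite -[s in leRHS](sqr_sqrtr s0) -exprMn ler_sqr ?nnegrE; last 2 first.
- by rewrite sumr_ge0.
- by rewrite mulr_ge0 ?sqrtr_ge0// sumr_ge0// => i _; rewrite sumr_ge0.
rewrite mulr_suml; apply: ler_sum => i _; rewrite mxE mulr_suml.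
apply: le_trans (ler_norm_sum _ _ _) (ler_sum _ _) => j _.
by rewrite quat_normM ler_wpM2l.
Qed.

(** At [B *m c] the form of [A] is minus the squared norm of [c], and a perturbation with entries at
    most [e] moves it by at most [e * b] times that squared norm; taking [e] as the inverse of
    [b + 1] makes this strictly smaller. *)
Lemma num_neg_eigenvalues_lsc n (A : 'M[quat R]_n) : A = adjmx A ->
  exists2 e : R, 0 < e & forall A' : 'M[quat R]_n, A' = adjmx A' ->
    (forall i j, `|A' i j - A i j| <= e) ->
    (num_neg_eigenvalues A <= num_neg_eigenvalues A')%N.
Proof.
move=> Ah; have [B BE] := exists_neg_orthonormal_family Ah.
set k := num_neg_eigenvalues A in B BE *.
pose b : R := (\sum_i \sum_j (`|B i j|)) ^+ 2.
have b1 : 0 < b + 1 by rewrite ltr_pwDr// sqr_ge0.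
exists (b + 1)^-1 => [|A' A'h A'A]; first by rewrite invr_gt0.
apply: (leq_num_neg_eigenvalues A'h (B := B)) => c c0.
rewrite -[A'](subrK A) -[A in X in qform X]opprK qformB qformN opprK BE subr_lt0.
apply: le_lt_trans (ler_norm _) _.
apply: le_lt_trans (@norm_qform_le _ _ _ _ (b + 1)^-1 _) _.
  by move=> i j; rewrite !mxE.
rewrite mulrC ltr_pdivrMr//; apply: le_lt_trans (sum_norm_mulmx_cV _ _) _.
by rewrite -/b opprK [ltRHS]mulrC ltr_pM2r ?qform1_gt0// ltrDl.
Qed.

End Perturbation.

(** * Partial sums of the kernel and their Gram matrices *)

Section PartialSums.
Context {R : realType} {N : nat}.
Implicit Types (p q : quat R).

Lemma kernel_series_cvg_entry (a : nat -> nat -> 'M[quat R]_N) p q S :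
  kernel_series_cvg a p q S ->
  forall e : R, 0 < e -> exists L, forall n m, (L <= n)%N -> (L <= m)%N ->
    forall i j, `|kernel_psum a p q (n, m) i j - S i j| <= e.
Proof.
move=> /cvg_ballP aS e e0; have := aS e e0.
case=> -[X Y] /= [[n0 _ Xn0] [m0 _ Ym0]] XY.
exists (maxn n0 m0) => n m; rewrite !geq_max => /andP[n0n _] /andP[_ m0m] i j.
have /= := XY (n, m) (conj (Xn0 n n0n) (Ym0 m m0m)).
by case=> _ /(_ i j); rewrite -ball_normE /= distrC => /ltW.
Qed.

Context (a : nat -> nat -> 'M[quat R]_N).
Hypothesis a_herm : forall n m, a n m = adjmx (a m n).

Lemma adjmx_kernel_psum p q n m :
  adjmx (kernel_psum a p q (n, m)) = kernel_psum a q p (m, n).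
Proof.
rewrite /kernel_psum /= exchange_big /=; apply/matrixP => i j.
rewrite adjmxE !summxE raddf_sum; apply: eq_bigr => k _.
rewrite !summxE raddf_sum; apply: eq_bigr => l _ /=.
rewrite -adjmxE !adjmxM mulmxA -a_herm !adjmx_scalar.
by rewrite quat_conjX quat_conjK -quat_conjX.
Qed.

(** The adjoint of a partial sum at [(p, q)] is one at [(q, p)] with the two bounds swapped, so
    square truncations past both thresholds compare the limits. *)
Lemma kernel_series_herm p q S T :
  kernel_series_cvg a p q S -> kernel_series_cvg a q p T -> S = adjmx T.
Proof.
move=> /kernel_series_cvg_entry cS /kernel_series_cvg_entry cT.
apply/matrixP => i j; apply/eqP; rewrite -subr_eq0 -normr_le0.
apply/ler_addgt0Pl => e e0; rewrite addr0.
have e20 : 0 < e / 2 by rewrite divr_gt0.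
have [L HL] := cS _ e20; have [L' HL'] := cT _ e20.
have := HL (maxn L L') (maxn L L') (leq_maxl _ _) (leq_maxl _ _) i j.
have := HL' (maxn L L') (maxn L L') (leq_maxr _ _) (leq_maxr _ _) j i.
rewrite -quat_norm_conj raddfB /= -!adjmxE adjmx_kernel_psum.
set x := kernel_psum _ _ _ _ _ _ => le1 le2.
rewrite [e]splitr -[S i j](subrK x) -addrA.
by apply: le_trans (ler_normD _ _) (lerD _ le1); rewrite distrC.
Qed.

Lemma coef_block_herm mu : coef_block a mu = adjmx (coef_block a mu).
Proof.
apply/matrixP => i j; rewrite !mxE.
have /matrixP/(_ (tagnat.sig2 i) (tagnat.sig2 j)) :=
  a_herm (tagnat.sig1 i) (tagnat.sig1 j).
by rewrite adjmxE.
Qed.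

Lemma gram_mxE (K : quat R -> quat R -> 'M[quat R]_N) M
    (p : 'I_M -> quat R) (c : 'I_M -> 'cV[quat R]_N) l j :
  gram_mx K p c l j = (adjmx (c l) *m K (p l) (p j) *m c j) 0 0.
Proof. by rewrite /gram_mx mxE. Qed.

Lemma gram_mx_herm (V : set (quat R)) (K : quat R -> quat R -> 'M[quat R]_N) M
    (p : 'I_M -> quat R) (c : 'I_M -> 'cV[quat R]_N) :
  hermitian_kernel V K -> (forall i, V (p i)) ->
  gram_mx K p c = adjmx (gram_mx K p c).
Proof.
move=> Kh Vp; apply/matrixP => i j; rewrite adjmxE ![gram_mx _ _ _ _ _]mxE.
by rewrite -adjmxE !adjmxM adjmxK mulmxA -Kh.
Qed.

Lemma gram_mx_psum mu M (p : 'I_M -> quat R) (c : 'I_M -> 'cV[quat R]_N) :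
  exists X, gram_mx (fun p q => kernel_psum a p q (mu.+1, mu.+1)) p c
    = adjmx X *m coef_block a mu *m X.
Proof.
(* Block [n] of [X] carries the powers of the conjugate points together with the vectors, so that
   only the coefficients remain in the middle. *)
pose Y n := \matrix_(i < N, j < M) (quat_conj (p j) ^+ n * c j i 0).
have colY n j : col j (Y n) = (quat_conj (p j) ^+ n)%:M *m c j.
  by rewrite mul_scalar_mx; apply/colP => i; rewrite !mxE.
have rowY n l : row l (adjmx (Y n)) = adjmx (c l) *m (p l ^+ n)%:M.
  have -> : row l (adjmx (Y n)) = adjmx (col l (Y n)).
    by apply/rowP => i; rewrite !mxE.
  by rewrite colY adjmxM adjmx_scalar -quat_conjX quat_conjK.
exists (\mxcol_(n < mu.+1) Y n).
have -> : adjmx (\mxcol_(n < mu.+1) Y n) = \mxrow_(n < mu.+1) adjmx (Y n).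
  by apply/matrixP => i j; rewrite !mxE.
rewrite /coef_block mul_mxrow_mxblock mul_mxrow_mxcol.
apply/matrixP => l j; rewrite mxE /kernel_psum /= exchange_big /=.
rewrite mulmx_sumr mulmx_suml !summxE; apply: eq_bigr => m _.
rewrite mulmx_sumr !mulmx_suml !summxE; apply: eq_bigr => n _.
rewrite !mulmxA -rowY -(mulmxA _ _ (c j)) -colY.
by rewrite -row_mul mxE [RHS]mxE; apply: eq_bigr => k _; rewrite !mxE.
Qed.

Lemma gram_mx_le_coef_block (V : set (quat R))
    (K : quat R -> quat R -> 'M[quat R]_N) M
    (p : 'I_M -> quat R) (c : 'I_M -> 'cV[quat R]_N) :
  (forall p q, V p -> V q -> kernel_series_cvg a p q (K p q)) ->
  (forall i, V (p i)) ->
  exists mu, (num_neg_eigenvalues (gram_mx K p c)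
              <= num_neg_eigenvalues (coef_block a mu))%N.
Proof.
move=> cK Vp.
have Kh : hermitian_kernel V K.
  by move=> x y Vx Vy; apply: kernel_series_herm; apply: cK.
have [e e0 lsc] := num_neg_eigenvalues_lsc (gram_mx_herm c Kh Vp).
(* [g] dominates the sum of the entry norms of every [c l], so an error of [e / (g ^+ 2 + 1)] in the
   kernel costs at most [e] in a Gram entry. *)
pose g := \sum_l \sum_i (`|c l i 0|).
have g0 : 0 <= g by rewrite sumr_ge0// => l _; rewrite sumr_ge0.
have cg l : \sum_i (`|c l i 0|) <= g.
  by rewrite /g (bigD1 l)//= lerDl sumr_ge0// => x _; rewrite sumr_ge0.
have e'0 : 0 < e / (g ^+ 2 + 1) by rewrite divr_gt0// ltr_pwDr// sqr_ge0.
have /choice[L HL] : forall lj : 'I_M * 'I_M, exists L, forall n m,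
    (L <= n)%N -> (L <= m)%N -> forall i j,
    `|kernel_psum a (p lj.1) (p lj.2) (n, m) i j - K (p lj.1) (p lj.2) i j|
    <= e / (g ^+ 2 + 1).
  by move=> lj; apply: kernel_series_cvg_entry => //; apply: cK.
(* [coef_block a mu] belongs to the truncation at [mu.+1], which is past every threshold [L lj]. *)
pose mu := \max_lj L lj; exists mu.
have [X GX] := gram_mx_psum mu p c.
have Ah := coef_block_herm mu.
apply: leq_trans (lsc _ _ _) (num_neg_eigenvalues_congruence X Ah).
  by rewrite !adjmxM adjmxK -coef_block_herm mulmxA.
move=> l j; rewrite -GX !gram_mxE.
have -> : forall u v : 'M[quat R]_1, u 0 0 - v 0 0 = (u - v) 0 0.
  by move=> u v; rewrite !mxE.
rewrite -mulmxBl -mulmxBr.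
have Lmu : (L (l, j) <= mu.+1)%N by apply: leqW; apply: leq_bigmax.
apply: le_trans (norm_sesquilinear_le _ _ (e := e / (g ^+ 2 + 1)) _) _.
  by move=> x y; have := HL (l, j) _ _ Lmu Lmu x y; rewrite !mxE.
rewrite -[leRHS](divfK (x := g ^+ 2 + 1)) ?gt_eqF ?ltr_pwDr ?sqr_ge0//.
apply: ler_wpM2l; first exact: ltW.
apply: (@le_trans _ _ (g ^+ 2)); last by rewrite lerDl.
by rewrite expr2 ler_pM ?cg// sumr_ge0.
Qed.

End PartialSums.

(** * Geometric growth of the coefficients *)

Section Growth.
Context {R : realType}.

(** Column [r] of the inverse Vandermonde matrix holds weights that extract the [r]-th coefficient
    of a polynomial from its values; distinct nodes make the determinant nonzero. *)
Lemma vandermonde_dual k (s : 'I_k -> R) : injective s ->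
  exists W : 'M[R]_k, forall n r : 'I_k, \sum_l s l ^+ n * W l r = (n == r)%:R.
Proof.
move=> s_inj; pose V := Vandermonde k (\row_l s l).
have Vunit : V \in unitmx.
  rewrite unitmxE det_Vandermonde unitfE; apply/prodf_neq0 => i _.
  apply/prodf_neq0 => j ij; rewrite !mxE subr_eq0 (inj_eq s_inj).
  by apply: contraTneq ij => ->; rewrite ltnn.
exists (invmx V) => n r; have /matrixP/(_ n r) := mulmxV Vunit.
by rewrite !mxE => <-; apply: eq_bigr => l _; rewrite !mxE.
Qed.

(** The dual weights recover the coefficients from the values at [k] points; [D] depends on the
    points alone, so it is uniform in [b] and [w]. *)
Lemma vandermonde_bound k (s : 'I_k -> R) : injective s ->
  exists2 D : R, 0 <= D & forall (b : nat -> quat R) w,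
    (forall l, `|\sum_(i < k) s l ^+ i *: b i| <= w) ->
    forall i : 'I_k, `|b i| <= D * w.
Proof.
move=> /vandermonde_dual[W WE]; exists (\sum_l \sum_r (`|W l r|)).
  by rewrite sumr_ge0// => l _; rewrite sumr_ge0.
move=> b w bw r.
have -> : b r = \sum_l W l r *: \sum_(i < k) s l ^+ i *: b i.
  under eq_bigr => l _ do rewrite scaler_sumr.
  rewrite exchange_big (bigD1 r)//= [X in _ + X]big1 => [|i ir].
    under eq_bigr => l _ do rewrite scalerA mulrC.
    by rewrite -scaler_suml WE eqxx scale1r addr0.
  under eq_bigr => l _ do rewrite scalerA mulrC.
  by rewrite -scaler_suml WE (negPf ir) scale0r.
apply: le_trans (ler_norm_sum _ _ _) _; rewrite mulr_suml; apply: ler_sum => l _.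
rewrite normrZ; apply: ler_pM => //.
by rewrite (bigD1 r)//= lerDl sumr_ge0.
Qed.

(** Otherwise the interval, which has measure [d], would lie in a countable union of finite sets. *)
Lemma uncountable_cover (d : R) (E : nat -> set R) : 0 < d ->
  (forall s, 0 < s < d -> exists k, E k s) -> exists k, infinite_set (E k).
Proof.
move=> d0 Ecover; apply: contrapT => Efin.
have : countable (\bigcup_k E k).
  apply: bigcup_countable => [|k _]; first exact: countableP.
  by apply: finite_set_countable; apply: contrapT => Ek; apply: Efin; exists k.
have dE : `]0, d[ `<=` \bigcup_k E k.
  by move=> s; rewrite /= in_itv /= => /Ecover[k Eks]; exists k.
move=> /(sub_countable (subset_card_le dE)) /countable_lebesgue_measure0.
rewrite lebesgue_measure_itv /= lte_fin d0 oppr0 adde0 => /eqP.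
by rewrite eqe gt_eqF.
Qed.

(* The bound depends on the point s only through k(s), which takes countably
   many values; so infinitely many points share the same bound, and enough of
   them determine the coefficients. *)
Lemma growth_of_bounded_sums (T : Type) (b : T -> nat -> quat R)
    (P : nat -> T -> Prop) (w : nat -> T -> R) (d : R) : 0 < d ->
  (forall s, 0 < s < d -> exists k, forall t n, P k t -> (k <= n)%N ->
     `|\sum_(i < n) s ^+ i *: b t i| <= w k t) ->
  exists k, exists2 C : R, 1 <= C &
    forall t n, P k t -> `|b t n| <= C ^+ n.+1 * w k t.
Proof.
move=> d0 bw; pose E k : set R := [set s | 0 < s < d /\
  forall t n, P k t -> (k <= n)%N -> `|\sum_(i < n) s ^+ i *: b t i| <= w k t].
have [k /(infinite_set_fset k.+1)[F FE Fk]] : exists k, infinite_set (E k).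
  by apply: (uncountable_cover d0) => s sd; have [k kP] := bw s sd; exists k.
pose s (i : 'I_k.+1) := nth 0 (finmap.enum_fset F) i.
have s_inj : injective s.
  move=> i j /eqP; rewrite nth_uniq ?finmap.fset_uniq// ?(leq_trans (ltn_ord _) Fk)//.
  by move=> /eqP/val_inj.
have sE i : E k (s i).
  by apply: FE; apply: mem_nth; apply: (leq_trans (ltn_ord i) Fk).
have [D D0 bD] := vandermonde_bound s_inj.
have [/andP[s0 _] _] := sE ord0; set s_0 := s ord0 in s0.
(* [D] covers the coefficients with [n <= k]; [2] and [s_0^-1] cover the later ones, which are
   differences of two consecutive partial sums. *)
have C1 : 1 <= D + 2 + s_0^-1.
  by rewrite -addrA addrCA (_ : 2 = 1 + 1)// -!addrA lerDl !addr_ge0// invr_ge0 ltW.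
exists k, (D + 2 + s_0^-1) => // t n Pkt.
have w0 : 0 <= w k t by have [_ /(_ t k Pkt (leqnn k))] := sE ord0; apply: le_trans.
set C := D + 2 + s_0^-1 in C1 *.
have [nk|kn] := leqP n k.
  have := bD (b t) (w k t) _ (Ordinal (nk : (n < k.+1)%N)) => /= bn.
  apply: le_trans (bn _) _ => [l|]; first by apply: (sE l).2.
  apply: ler_wpM2r => //; apply: (@le_trans _ _ C).
    by rewrite /C -addrA lerDl addr_ge0// invr_ge0 ltW.
  exact: ler_eXnr.
have := (sE ord0).2 t n.+1 Pkt (leqW (ltnW kn)).
have := (sE ord0).2 t n Pkt (ltnW kn).
rewrite big_ord_recr /= -/s_0; set u := \sum_(i < n) _ => un un1.
have : `|s_0 ^+ n *: b t n| <= 2 * w k t.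
  rewrite -[_ *: _](addKr u) mulrDl mul1r.
  by apply: le_trans (ler_normD _ _) (lerD _ un1); rewrite normrN.
have sn0 : 0 < s_0 ^+ n by rewrite exprn_gt0.
rewrite normrZ (gtr0_norm sn0) mulrC -ler_pdivlMr//.
move=> /le_trans; apply; rewrite mulrAC; apply: ler_wpM2r => //.
rewrite exprS; apply: ler_pM => //.
- by rewrite invr_ge0 exprn_ge0 ?ltW.
- by rewrite /C addrAC lerDr addr_ge0// invr_ge0 ltW.
- rewrite -exprVn; apply: lerXn2r; rewrite ?nnegrE ?invr_ge0 ?(ltW s0)//.
    exact: le_trans ler01 C1.
  by rewrite /C lerDr addr_ge0.
Qed.

Lemma nat_upper_bound (x : R) : exists n : nat, x <= n%:R.
Proof. by exists (Num.truncn x).+1; rewrite ltW// truncnS_gt. Qed.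

(** [growth_of_bounded_sums] is applied twice. With [t] fixed, the row sums truncated at [m] are
    coefficients of a polynomial in [s], with [m] as parameter, and this bounds them for large [m].
    Each row is then itself a series in [t], with the row index as parameter. *)
Lemma double_growth (x : nat -> nat -> quat R) (d : R) : 0 < d ->
  (forall s t, 0 < s < d -> 0 < t < d -> exists k, forall n m,
     (k <= n)%N -> (k <= m)%N ->
     `|\sum_(i < n) \sum_(j < m) (s ^+ i * t ^+ j) *: x i j| <= k%:R) ->
  exists2 G : R, 1 <= G & forall n m, `|x n m| <= G ^+ (n + m + 3).
Proof.
move=> d0 xb.
have rows t : 0 < t < d -> exists k, forall n m, xpredT n -> (k <= m)%N ->
    `|\sum_(j < m) t ^+ j *: x n j| <= k%:R ^+ n.+2.
  move=> td; pose r m n := \sum_(j < m) t ^+ j *: x n j.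
  have [s sd|k [C C1 rC]] := @growth_of_bounded_sums nat r (fun k m => (k <= m)%N)
      (fun k _ => k%:R) d d0.
    have [k xk] := xb s t sd td; exists k => m n km kn.
    have := xk n m kn km; congr (`|_| <= _); apply: eq_bigr => i _.
    by rewrite scaler_sumr; apply: eq_bigr => j _; rewrite scalerA.
  (* The constant is rounded up because the bounds fed to the second application must be indexed by
     a natural number. *)
  have [c Cc] := nat_upper_bound C.
  exists (maxn c k) => n m _; rewrite geq_max => /andP[_ /(rC _ n) rn].
  have C0 : 0 <= C := le_trans ler01 C1.
  apply: le_trans rn _; rewrite [leRHS]exprSr.
  apply: ler_pM; rewrite ?exprn_ge0// ?ler_nat ?leq_maxr//.
  apply: lerXn2r; rewrite ?nnegrE//.
  by rewrite (le_trans Cc)// ler_nat leq_maxl.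
have [k [C C1 xC]] := growth_of_bounded_sums (P := fun _ => xpredT) d0 rows.
have [c Cc] := nat_upper_bound (C + k%:R).
have c1 : 1 <= c%:R :> R by rewrite (le_trans C1)// (le_trans _ Cc)// lerDl.
exists c%:R => // n m; apply: le_trans (xC n m isT) _.
(* The exponent [m.+1] comes from the series in [t], and [n.+2] from the bound on the truncated
   rows. *)
have -> : (n + m + 3 = m.+1 + n.+2)%N by lia.
have C0 : 0 <= C := le_trans ler01 C1.
rewrite exprD; apply: ler_pM; rewrite ?exprn_ge0//.
  by apply: lerXn2r; rewrite ?nnegrE// (le_trans _ Cc)// lerDl.
by apply: lerXn2r; rewrite ?nnegrE// (le_trans _ Cc)// lerDr.
Qed.

End Growth.

(** * Dual weights at small real points *)

Section CoefficientRecovery.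
Context {R : realType}.

Lemma sum_geometric_le2 (q : R) L : 0 <= q <= 2^-1 -> \sum_(i < L) q ^+ i <= 2.
Proof.
move=> /andP[q0 q2]; elim: L => [|L IHL]; first by rewrite big_ord0.
rewrite big_ord_recl expr0; under eq_bigr => i _ do rewrite exprS.
rewrite -mulr_sumr; set S := \sum_(i < L) _ in IHL *.
have : q * S <= 2^-1 * 2 by rewrite ler_pM// sumr_ge0// => i _; rewrite exprn_ge0.
by rewrite mulVf//; lra.
Qed.

(** The first [mu.+1] terms reduce to [G ^+ r], since those moments are Kronecker deltas; the tail
    is dominated by a geometric series with sum at most 2. *)
Lemma sum_weights_le mu (r : 'I_mu.+1) L (h : nat -> R) (G th q : R) :
  0 <= q <= 2^-1 -> 0 <= th ->
  (forall n : 'I_mu.+1, h n = (n == r)%:R) ->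
  (forall i, `|h (mu.+1 + i)%N| * G ^+ (mu.+1 + i) <= th * q ^+ i) ->
  \sum_(n < mu.+1 + L) `|h n| * G ^+ n <= G ^+ r + 2 * th.
Proof.
move=> q2 th0 hr hq; rewrite big_split_ord /=; apply: lerD.
  rewrite (bigD1 r)//= big1 => [|i /negPf ir].
    by rewrite hr eqxx normr1 mul1r addr0.
  by rewrite hr ir normr0 mul0r.
apply: (@le_trans _ _ (\sum_(i < L) th * q ^+ i)).
  by apply: ler_sum => i _; apply: hq.
by rewrite -mulr_sumr mulrC ler_wpM2r// sum_geometric_le2.
Qed.

(** Since [h r] and [h' s] are 1, the coefficient of [x r s] is exact; removing its share
    [G ^+ r * G ^+ s] from the product of the two weighted sums leaves a bound for all the other
    terms. *)
Lemma double_sum_close (x : nat -> nat -> quat R) (G A B : R) L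
    (r s : 'I_L) (h h' : nat -> R) : 0 <= G ->
  (forall n m, `|x n m| <= G ^+ (n + m + 3)) ->
  h r = 1 -> h' s = 1 ->
  \sum_(n < L) `|h n| * G ^+ n <= A -> \sum_(n < L) `|h' n| * G ^+ n <= B ->
  `|\sum_(n < L) \sum_(m < L) (h n * h' m) *: x n m - x r s|
  <= G ^+ 3 * (A * B - G ^+ r * G ^+ s).
Proof.
move=> G0 xG hr hs hA hB.
pose d (n m : 'I_L) : R := ((n == r) && (m == s))%:R.
have dE F : \sum_(n < L) \sum_(m < L) d n m * F n m = F r s :> R.
  rewrite (bigD1 r)//= [X in _ + X]big1 => [|n /negPf nr]; last first.
    by rewrite big1// => m _; rewrite /d nr mul0r.
  rewrite (bigD1 s)//= [X in _ + X + _]big1 => [|m /negPf ms]; last first.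
    by rewrite /d ms andbF mul0r.
  by rewrite /d !eqxx mul1r !addr0.
have xE : x r s = \sum_(n < L) \sum_(m < L) d n m *: x n m.
  rewrite (bigD1 r)//= [X in _ + X]big1 => [|n /negPf nr]; last first.
    by rewrite big1// => m _; rewrite /d nr scale0r.
  rewrite (bigD1 s)//= [X in _ + X + _]big1 => [|m /negPf ms]; last first.
    by rewrite /d ms andbF scale0r.
  by rewrite /d !eqxx scale1r !addr0.
have AB : (\sum_(n < L) `|h n| * G ^+ n) * (\sum_(n < L) `|h' n| * G ^+ n)
    <= A * B.
  by rewrite ler_pM// sumr_ge0// => n _; rewrite mulr_ge0// exprn_ge0.
apply: (@le_trans _ _ (G ^+ 3 * \sum_(n < L) \sum_(m < L)
    (`|h n| * `|h' m| - d n m) * (G ^+ n * G ^+ m))); last first.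
  rewrite ler_wpM2l ?exprn_ge0//.
  under eq_bigr => n _ do under eq_bigr => m _ do rewrite mulrBl.
  under eq_bigr => n _ do rewrite sumrB.
  rewrite sumrB (dE (fun n m => G ^+ n * G ^+ m)) lerB//.
  apply: le_trans AB; rewrite mulr_suml; apply: ler_sum => n _.
  rewrite mulr_sumr; apply: ler_sum => m _.
  by rewrite mulrACA.
rewrite xE -sumrB mulr_sumr.
apply: le_trans (ler_norm_sum _ _ _) (ler_sum _ _) => n _.
rewrite -sumrB mulr_sumr.
apply: le_trans (ler_norm_sum _ _ _) (ler_sum _ _) => m _.
rewrite -scalerBl normrZ.
have -> : `|h n * h' m - d n m| = `|h n| * `|h' m| - d n m.
  rewrite /d; case: eqP => [->|_]; last by rewrite !subr0 normrM.
  case: eqP => [->|_]; last by rewrite !subr0 normrM.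
  by rewrite hr hs !normr1 mulr1 subrr normr0.
have hd : 0 <= `|h n| * `|h' m| - d n m.
  rewrite /d; case: eqP => [->|_]; last by rewrite subr0 mulr_ge0.
  case: eqP => [->|_]; last by rewrite subr0 mulr_ge0.
  by rewrite hr hs !normr1 mulr1 subrr.
rewrite mulrCA; apply: ler_wpM2l => //; apply: le_trans (xG n m) _.
by rewrite -!exprD addnC.
Qed.

(* Rescaling the dual Vandermonde weights of the points l to the points eps * l
   leaves the moments of order at most mu unchanged and makes the higher ones
   O(eps), even after weighting them by the growth G ^ n of the coefficients. *)
Lemma small_dual_weights mu (G d del : R) : 1 <= G -> 0 < d -> 0 < del ->
  exists (s : 'I_mu.+1 -> R) (W : 'M[R]_mu.+1), (forall l, `|s l| < d) /\
    forall r, let h n := \sum_l s l ^+ n * W l r in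
      h r = 1 /\
      forall L, \sum_(n < mu.+1 + L) `|h n| * G ^+ n <= G ^+ r + del.
Proof.
move=> G1 d0 del0; pose t (l : 'I_mu.+1) : R := (l : nat)%:R.
have t_inj : injective t by move=> l l' /eqP; rewrite eqr_nat => /eqP/val_inj.
have [W WE] := vandermonde_dual t_inj.
have G0 : 0 < G by apply: lt_le_trans ltr01 G1.
pose tau : R := mu.+1%:R; have tau0 : 0 < tau by rewrite ltr0n.
have t_le l : `|t l| <= tau by rewrite ger0_norm// ler_nat ltnW.
pose om := \sum_l \sum_r (`|W l r|).
have om0 : 0 <= om by rewrite sumr_ge0// => l _; rewrite sumr_ge0.
pose c := om * (tau * G) ^+ mu.+1.
have c0 : 0 <= c by rewrite mulr_ge0// exprn_ge0// mulr_ge0// ltW.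
(* The four bounds on [eps] serve, in order, the estimate of its powers, a geometric ratio at most
   1/2, points within [d] of 0, and a total tail at most [del]. *)
pose eps := Num.min 1 (Num.min ((tau * G)^-1 / 2)
  (Num.min (d / tau / 2) (del / (c + 1) / 2))).
have eps0 : 0 < eps.
  by rewrite !lt_min ltr01 !divr_gt0 ?invr_gt0 ?mulr_gt0// ltr_pwDr.
have [eps1 [epsG [epsd epsc]]] : [/\ eps <= 1, eps <= (tau * G)^-1 / 2,
    eps <= d / tau / 2 & eps <= del / (c + 1) / 2].
  by split; rewrite !ge_min lexx ?orbT.
have tauG0 : 0 < tau * G by rewrite mulr_gt0.
have eps_ge0 := ltW eps0.
exists (fun l => eps * t l), (\matrix_(l, r) (W l r * eps ^- r)).
split=> [l|r h].
  rewrite normrM gtr0_norm//; apply: le_lt_trans (ler_wpM2l eps_ge0 (t_le l)) _.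
  apply: (@le_lt_trans _ _ (d / 2)); last by rewrite gtr_pMr// invf_lt1// ltr1n.
  by rewrite -ler_pdivlMr// mulrAC.
have hE n : h n = eps ^+ n * eps ^- r * \sum_l t l ^+ n * W l r.
  by rewrite mulr_sumr; apply: eq_bigr => l _; rewrite mxE exprMn; ring.
have hr (n : 'I_mu.+1) : h n = (n == r)%:R.
  rewrite hE WE; case: eqP => [->|_]; last by rewrite mulr0.
  by rewrite mulr1 mulfV// expf_neq0// gt_eqF.
split=> [|L]; first by rewrite hr eqxx.
apply: le_trans (@sum_weights_le _ r L h G (eps * c) (eps * (tau * G)) _ _ hr _) _.
- apply/andP; split; first by rewrite mulr_ge0// ltW.
  by rewrite -ler_pdivlMr// mulrC.
- by rewrite mulr_ge0.
- move=> i; rewrite hE; set M := mu.+1.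
  (* As [r <= mu], the exponent [M + i - r] is at least [i + 1], which leaves a spare factor
     [eps]. *)
  have epsM : eps ^+ (M + i) * eps ^- r <= eps * eps ^+ i.
    have -> : (M + i = r + (M - r).-1.+1 + i)%N.
      by rewrite prednK ?subn_gt0// subnKC// ltnW.
    rewrite !exprD exprS mulrC !mulrA mulVf ?expf_neq0 ?gt_eqF// mul1r.
    by rewrite -mulrA ler_wpM2l// ler_piMl ?exprn_ge0// exprn_ile1.
  have tW : `|\sum_l t l ^+ (M + i) * W l r| <= om * tau ^+ (M + i).
    rewrite mulrC mulr_sumr.
    apply: le_trans (ler_norm_sum _ _ _) (ler_sum _ _) => l _.
    rewrite normrM normrX ler_pM ?exprn_ge0//.
      by apply: lerXn2r; rewrite ?nnegrE// ltW.
    by rewrite (bigD1 r)//= lerDl sumr_ge0.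
  have -> : eps * c * (eps * (tau * G)) ^+ i
      = eps * eps ^+ i * (om * tau ^+ (M + i)) * G ^+ (M + i).
    by rewrite /c -/M !exprMn !exprD; ring.
  rewrite normrM ger0_norm ?mulr_ge0 ?invr_ge0 ?exprn_ge0//.
  apply: ler_wpM2r; first by rewrite exprn_ge0// ltW.
  by apply: ler_pM; rewrite ?mulr_ge0 ?invr_ge0 ?exprn_ge0.
have : eps * (c + 1) <= del / 2 by rewrite -ler_pdivlMr ?ltr_pwDr// mulrAC.
by rewrite lerD2l mulrDr mulr1; lra.
Qed.

End CoefficientRecovery.

(** * Kernel values at real points against coefficient blocks *)

Section RealPoints.
Context {R : realType} {N : nat} (a : nat -> nat -> 'M[quat R]_N).

Lemma kernel_psum_real (s t : R) n m i j :
  kernel_psum a (quat_real s) (quat_real t) (n, m) i j =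
  \sum_(k < n) \sum_(l < m) (s ^+ k * t ^+ l) *: a k l i j.
Proof.
rewrite /kernel_psum /= summxE; apply: eq_bigr => k _.
rewrite summxE; apply: eq_bigr => l _.
rewrite quat_conj_real -!rmorphXn /= real_scalar_mxC mulmxA -scalar_mxM.
by rewrite mul_scalar_mx mxE -rmorphM /= quat_realM mulrC.
Qed.

Context (V : set (quat R)) (K : quat R -> quat R -> 'M[quat R]_N).
Hypothesis V_nbhs : nbhs (0 : quat R) V.
Hypothesis K_cvg : forall p q, V p -> V q -> kernel_series_cvg a p q (K p q).

Lemma nbhs0_quat_real : exists2 d : R, 0 < d &
  forall s, `|s| < d -> V (quat_real s).
Proof.
have /nbhs_ballP[d /= d0 dV] := V_nbhs; exists d => // s sd; apply: dV.
by rewrite -ball_normE /= sub0r normrN quat_norm_real.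
Qed.

(** At real points each entry of the kernel is a double power series in two real variables, to which
    [double_growth] applies; summing over the index pairs makes [G] common to all entries. *)
Lemma coef_growth : exists2 G : R, 1 <= G &
  forall n m i j, `|a n m i j| <= G ^+ (n + m + 3).
Proof.
have [d d0 dV] := nbhs0_quat_real.
have growth ij : exists G : R, 1 <= G /\
    forall n m, `|a n m ij.1 ij.2| <= G ^+ (n + m + 3).
  have [s t /andP[s0 sd] /andP[t0 td]|G G1 xG] :=
    @double_growth _ (fun n m => a n m ij.1 ij.2) d d0; last by exists G.
  have cK := K_cvg (dV s _) (dV t _); rewrite !gtr0_norm// in cK.
  have [L HL] := kernel_series_cvg_entry (cK sd td) ltr01.
  set S := K _ _ in HL.
  have [c Sc] := nat_upper_bound (1 + `|S ij.1 ij.2|).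
  (* In [double_growth] one number is both the threshold and the bound, hence the maximum. *)
  exists (maxn L c) => n m; rewrite !geq_max => /andP[Ln cn] /andP[Lm _].
  rewrite -kernel_psum_real; apply: (@le_trans _ _ c%:R).
    apply: le_trans Sc; have := HL n m Ln Lm ij.1 ij.2.
    set u := kernel_psum _ _ _ _ _ _ => uS.
    by rewrite -[u](subrK (S ij.1 ij.2)) (le_trans (ler_normD _ _))// lerD2r.
  by rewrite ler_nat leq_maxr.
have [G GP] := choice growth.
exists (1 + \sum_ij G ij) => [|n m i j].
  by rewrite lerDl sumr_ge0// => ij _; have [/(le_trans ler01)] := GP ij.
have [G1 /(_ n m)] := GP (i, j); move=> /le_trans; apply.
have G0 := le_trans ler01 G1.
apply: lerXn2r; rewrite ?nnegrE//.
  by rewrite addr_ge0// sumr_ge0// => ij _; have [/(le_trans ler01)] := GP ij.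
rewrite (bigD1 (i, j))//= addrCA lerDl addr_ge0// sumr_ge0// => ij _.
by have [/(le_trans ler01)] := GP ij.
Qed.

(** Half of [e] pays for replacing [K] by a long partial sum, the other half for the moments of
    order above [mu], which [small_dual_weights] makes small. *)
Lemma coef_recovery mu (d e : R) : 0 < d -> 0 < e ->
  (forall s, `|s| < d -> V (quat_real s)) ->
  exists (s : 'I_mu.+1 -> R) (W : 'M[R]_mu.+1), (forall l, `|s l| < d) /\
    forall (r r' : 'I_mu.+1) i i',
      `|\sum_l \sum_j (W l r * W j r') *:
           K (quat_real (s l)) (quat_real (s j)) i i' - a r r' i i'| <= e.
Proof.
move=> d0 e0 dV; have [G G1 aG] := coef_growth.
have G0 : 0 < G := lt_le_trans ltr01 G1.
(* With [del <= 1], the excess of [(G ^+ r + del) * (G ^+ r' + del)] over [G ^+ r * G ^+ r'] is at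
   most [(2 * G ^+ mu + 1) * del]; the factor [G ^+ 3] comes from [double_sum_close]. *)
pose b := G ^+ 3 * (2 * G ^+ mu + 1).
have b0 : 0 < b.
  by rewrite mulr_gt0 ?exprn_gt0// ltr_pwDr// mulr_ge0// exprn_ge0 ?ltW.
pose del := Num.min 1 (e / 2 / b).
have del0 : 0 < del by rewrite lt_min ltr01 !divr_gt0.
have [del1 delb] : del <= 1 /\ del <= e / 2 / b by split; rewrite ge_min lexx ?orbT.
have [s [W [sd sW]]] := small_dual_weights mu G1 d0 del0.
exists s, W; split=> // r r' i i'.
pose om := \sum_l \sum_j (`|W l r * W j r'|).
have om0 : 0 <= om by rewrite sumr_ge0// => l _; rewrite sumr_ge0.
have eta0 : 0 < e / 2 / (om + 1) by rewrite !divr_gt0// ltr_pwDr.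
have /choice[L HL] : forall lj : 'I_mu.+1 * 'I_mu.+1, exists L, forall n m,
    (L <= n)%N -> (L <= m)%N -> forall i j,
    `|kernel_psum a (quat_real (s lj.1)) (quat_real (s lj.2)) (n, m) i j -
      K (quat_real (s lj.1)) (quat_real (s lj.2)) i j| <= e / 2 / (om + 1).
  by move=> lj; apply: kernel_series_cvg_entry => //; apply: K_cvg; apply: dV.
(* This truncation has the form [mu.+1 + L] required by [small_dual_weights] and is past all
   thresholds. *)
pose M := (mu.+1 + \max_lj L lj)%N.
have LM l j : (L (l, j) <= M)%N.
  by apply: leq_trans (leq_addl _ _); apply: leq_bigmax.
pose P l j := kernel_psum a (quat_real (s l)) (quat_real (s j)) (M, M) i i'.
pose S := \sum_l \sum_j (W l r * W j r') *: P l j.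
pose h r n := \sum_l s l ^+ n * W l r.
(* Exchanging the sums turns the combination of point values into one of coefficients weighted by
   the moments [h]. *)
have SE : S = \sum_(n < M) \sum_(m < M) (h r n * h r' m) *: a n m i i'.
  rewrite /S; under eq_bigr => l _ do under eq_bigr => j _ do
    rewrite /P kernel_psum_real scaler_sumr.
  under eq_bigr => l _ do rewrite exchange_big.
  rewrite exchange_big; apply: eq_bigr => n _.
  under eq_bigr => l _ do under eq_bigr => j _ do rewrite scaler_sumr.
  under eq_bigr => l _ do rewrite exchange_big.
  rewrite exchange_big; apply: eq_bigr => m _.
  rewrite /h mulr_suml scaler_suml; apply: eq_bigr => l _.
  rewrite mulr_sumr scaler_suml; apply: eq_bigr => j _.
  by rewrite scalerA; congr (_ *: _); ring.
have Sa : `|S - a r r' i i'| <= e / 2.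
  have [hr sumr] := sW r; have [hr' sumr'] := sW r'.
  have := @double_sum_close _ (fun n m => a n m i i') G _ _ M
    (lshift _ r) (lshift _ r') (h r) (h r') (ltW G0)
    (fun n m => aG n m i i') hr hr' (sumr _) (sumr' _).
  rewrite -SE /= => /le_trans; apply.
  have Gmu (k : 'I_mu.+1) : G ^+ k <= G ^+ mu by rewrite ler_weXn2l// -ltnS.
  apply: (@le_trans _ _ (b * del)); last by rewrite mulrC -ler_pdivlMr.
  rewrite /b -mulrA; apply: ler_wpM2l; first by rewrite exprn_ge0// ltW.
  have := Gmu r; have := Gmu r'.
  move=> /(ler_wpM2r (ltW del0)) r'_mu /(ler_wpM2r (ltW del0)) r_mu.
  have del2 : del * del <= del by rewrite ler_piMl// ltW.
  by lra.
have SK : `|\sum_l \sum_j (W l r * W j r') *: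
    K (quat_real (s l)) (quat_real (s j)) i i' - S| <= e / 2.
  apply: (@le_trans _ _ (om * (e / 2 / (om + 1)))); last first.
    rewrite mulrA ler_pdivrMr ?ltr_pwDr// mulrC ler_wpM2l ?lerDl//.
    by rewrite divr_ge0 ?ltW.
  rewrite /S -sumrB mulr_suml.
  apply: le_trans (ler_norm_sum _ _ _) (ler_sum _ _) => l _.
  rewrite -sumrB mulr_suml.
  apply: le_trans (ler_norm_sum _ _ _) (ler_sum _ _) => j _.
  rewrite -scalerBr normrZ; apply: ler_wpM2l => //.
  by rewrite distrC; apply: (HL (l, j)); apply: LM.
by rewrite [e]splitr -(subrK S (\sum_l _)) -addrA (le_trans (ler_normD _ _))// lerD.
Qed.

(** Each row of [coef_block a mu] gets a point depending on its block and a basis vector depending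
    on its position there. The Gram matrix is then the block matrix of values of [K], and congruence
    by [Z], which is [W] tensored with the identity, brings it within [e] of [coef_block a mu]. *)
Lemma coef_block_le_gram mu : (forall n m, a n m = adjmx (a m n)) ->
  exists (p : 'I_(\sum_(n < mu.+1) N) -> quat R) c, (forall x, V (p x)) /\
    (num_neg_eigenvalues (coef_block a mu)
     <= num_neg_eigenvalues (gram_mx K p c))%N.
Proof.
move=> a_herm; have [d d0 dV] := nbhs0_quat_real.
have [e e0 lsc] := num_neg_eigenvalues_lsc (coef_block_herm a_herm mu).
have [s [W [sd sW]]] := coef_recovery mu d0 e0 dV.
pose p (x : 'I_(\sum_(n < mu.+1) N)) := quat_real (s (tagnat.sig1 x)).
pose c (x : 'I_(\sum_(n < mu.+1) N)) : 'cV[quat R]_N :=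
  delta_mx (tagnat.sig2 x) 0.
have Vp x : V (p x) by apply: dV.
exists p, c; split=> //.
pose Kb l j := K (quat_real (s l)) (quat_real (s j)).
have GE : gram_mx K p c = \mxblock_(l < mu.+1, j < mu.+1) Kb l j.
  apply/matrixP => x y; rewrite gram_mxE [RHS]mxE.
  have -> : adjmx (c x) = delta_mx 0 (tagnat.sig2 x).
    apply/matrixP => i j; rewrite !mxE andbC.
    by case: andP => _; [apply: (quat_conj_real 1) | apply: (quat_conj_real 0)].
  by rewrite -rowE -colE !mxE.
pose D l r : 'M[quat R]_N := (quat_real (W l r))%:M.
pose Z := \mxblock_(l < mu.+1, r < mu.+1) D l r.
have ZE : adjmx Z = \mxblock_(r < mu.+1, l < mu.+1) D l r.
  apply/matrixP => x y; rewrite !mxE eq_sym; case: eqP => _.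
    exact: quat_conj_real.
  exact: (quat_conj_real 0).
have Gh : gram_mx K p c = adjmx (gram_mx K p c).
  apply: (gram_mx_herm (V := V)) => // x y Vx Vy.
  by apply: (kernel_series_herm a_herm); apply: K_cvg.
apply: leq_trans (lsc _ _ _) (num_neg_eigenvalues_congruence Z Gh).
  by rewrite !adjmxM adjmxK -Gh mulmxA.
move=> x y; rewrite ZE GE /Z !mul_mxblock.
rewrite /coef_block [X in `|X - _|]mxE [X in `|_ - X|]mxE.
set r := tagnat.sig1 x; set r' := tagnat.sig1 y.
apply: le_trans (sW r r' (tagnat.sig2 x) (tagnat.sig2 y)); rewrite le_eqVlt.
apply/orP; left; apply/eqP; congr (`|_ - _|); rewrite exchange_big summxE.
apply: eq_bigr => j _; rewrite mulmx_suml summxE; apply: eq_bigr => l _.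
rewrite real_scalar_mxC mulmxA -scalar_mxM mul_scalar_mx mxE.
by rewrite -rmorphM quat_realM mulrC.
Qed.

End RealPoints.

Theorem proposition5p1 (R : realType) (N : nat) (N_gt0 : (0 < N)%N)
    (a : nat -> nat -> 'M[quat R]_N)
    (a_herm : forall n m, a n m = adjmx (a m n))
    (V : set (quat R)) (V_nbhs : nbhs (0 : quat R) V)
    (K : quat R -> quat R -> 'M[quat R]_N)
    (K_cvg : forall p q, V p -> V q -> kernel_series_cvg a p q (K p q))
    (kappa : nat) :
  has_negative_squares V K kappa <->
  ((forall mu : nat, (num_neg_eigenvalues (coef_block a mu) <= kappa)%N) /\
   (exists mu : nat, num_neg_eigenvalues (coef_block a mu) = kappa)).
Proof.
have gram_le M (p : 'I_M -> quat R) c :=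
  gram_mx_le_coef_block a_herm (p := p) c K_cvg.
have coef_le mu := coef_block_le_gram V_nbhs K_cvg mu a_herm.
split=> [[_ gram_kappa [M [p [c [_ Vp pc_kappa]]]]]|[coef_kappa [mu mu_kappa]]].
  have le_kappa mu : (num_neg_eigenvalues (coef_block a mu) <= kappa)%N.
    have [p' [c' [Vp' /leq_trans]]] := coef_le mu; apply; apply: gram_kappa => //.
    (* [N_gt0] makes the family of points nonempty. *)
    by rewrite sum_nat_const card_ord muln_gt0.
  (* A block dominating the extremal Gram matrix has at least, hence exactly, [kappa] negative
     eigenvalues. *)
  split=> //; have [mu pc_mu] := gram_le M p c Vp; exists mu.
  by apply/eqP; rewrite eqn_leq le_kappa -pc_kappa.
have le_kappa M (p : 'I_M -> quat R) c : (forall i, V (p i)) ->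
    (num_neg_eigenvalues (gram_mx K p c) <= kappa)%N.
  by move=> Vp; have [nu /leq_trans] := gram_le M p c Vp; apply.
split=> [p q Vp Vq|M p c _|].
- by apply: (kernel_series_herm a_herm); apply: K_cvg.
- exact: le_kappa.
(* Symmetrically, a Gram matrix dominating the extremal block attains [kappa]. *)
have [p [c [Vp mu_pc]]] := coef_le mu; exists _, p, c; split=> //.
  by rewrite sum_nat_const card_ord muln_gt0.
by apply/eqP; rewrite eqn_leq le_kappa// -mu_kappa.
Qed.
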